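(* Let $n \geq 2$ be an integer and let $r$ be a real number. Then $r$ is the asymptotic density of some $n$-c.e. set if and only if $r \in [0,1]$ and $r$ is a difference of two left-$\Pi^0_2$ reals (i.e. $r \in \mathcal{D}_2 \cap [0,1]$). Hence the set of reals which are asymptotic densities of $n$-c.e. sets equals the set of reals which are asymptotic densities of $2$-c.e. sets.
   Context: For $X \subseteq \omega=\{0,1,2,\dots\}$ and an integer $m>0$, let $\rho_m(X) = |\{j \in X : j < m\}|/m$. The set $X$ has a (asymptotic) density if $\lim_m \rho_m(X)$ exists, and the density is then $\rho(X) = \lim_m \rho_m(X)$. Saying that $r$ is the density of a set $X$ means that $X$ has a density and $\rho(X)=r$. Sets are identified with their characteristic functions. For a natural number $n$, a set $A \subseteq \omega$ is $n$-c.e. if there is a computable function $g:\omega\times\omega\to\{0,1\}$ such that for all $x$: $g(x,0)=0$, $A(x)=\lim_s g(x,s)$, and $|\{s : g(x,s) \neq g(x,s+1)\}| \leq n$. A real $r$ is left-$\Pi^0_2$ if its left Dedekind cut $\{q \in \mathbb{Q} : q < r\}$ is a $\Pi^0_2$ set. $\mathcal{D}_2$ is the set of all reals of the form $a-b$ where $a$ and $b$ are left-$\Pi^0_2$ reals. *)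

(* Defs.v *)
From HB Require Import structures.
From mathcomp Require Import all_boot all_order all_algebra.
From mathcomp Require Import all_classical all_reals all_analysis.

Set Implicit Arguments.
Unset Strict Implicit.
Unset Printing Implicit Defensive.

Import Order.TTheory GRing.Theory Num.Theory.
Import numFieldNormedType.Exports.

Local Open Scope classical_set_scope.
Local Open Scope card_scope.

(* Kleene's schemes for partial recursive functions of arity k. In [rprec] the
   recursion variable is the first argument, and the step function receives the
   predecessor, then the previous value, then the parameters. In [rmu] the
   variable searched for is the first argument. *)
Inductive recf : nat -> Type :=
| rzero k : recf k
| rsucc : recf 1
| rproj k (i : 'I_k) : recf k
| rcomp m k (f : recf m) (h : 'I_m -> recf k) : recf k
| rprec k (f : recf k) (h : recf k.+2) : recf k.+1
| rmu k (f : recf k.+1) : recf k.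

Fixpoint prec_graph (base : nat -> Prop) (step : nat -> nat -> nat -> Prop)
    (t y : nat) : Prop :=
  match t with
  | 0 => base y
  | t'.+1 => exists2 z, prec_graph base step t' z & step t' z y
  end.

(* [eval c v y]: the computation of [c] on input [v] converges to [y]. A search
   [rmu f] converges to [y] only if [f] converges at every smaller value. *)
Fixpoint eval k (c : recf k) : k.-tuple nat -> nat -> Prop :=
  match c in recf k return k.-tuple nat -> nat -> Prop with
  | rzero _ => fun _ y => y = 0
  | rsucc => fun v y => y = (thead v).+1
  | rproj _ i => fun v y => y = tnth v i
  | rcomp m _ f h => fun v y =>
      exists2 w : m.-tuple nat,
        (forall i, eval (h i) v (tnth w i)) & eval f w y
  | rprec _ f h => fun v y =>
      prec_graph (eval f (behead_tuple v))
        (fun t z => eval h (cons_tuple t (cons_tuple z (behead_tuple v))))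
        (thead v) y
  | rmu _ f => fun v y =>
      eval f (cons_tuple y v) 0 /\
      forall z, z < y -> exists t, eval f (cons_tuple z v) t.+1
  end.

Definition computable k (f : k.-tuple nat -> nat) : Prop :=
  exists c : recf k, forall v, eval c v (f v).

Definition n_ce (n : nat) (A : set nat) : Prop :=
  exists g : nat -> nat -> bool,
    [/\ computable (fun v : 2.-tuple nat => g (tnth v ord0) (tnth v ord_max)),
        forall x, g x 0 = false,
        forall x, \forall s \near \oo, g x s = (x \in A) &
        forall x, [set s | g x s != g x s.+1] #<= `I_n].

Definition Pi02 k (P : set (k.-tuple nat)) : Prop :=
  exists2 g : k.+2.-tuple nat -> bool,
    computable (fun w => g w) &
    forall v, P v <-> forall x, exists y, g (cons_tuple x (cons_tuple y v)).

Local Open Scope ring_scope.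

(* The triple (a, b, c) of natural numbers names the rational (a - b) / (c + 1);
   every rational has a name. *)
Definition rat_of_triple (v : 3.-tuple nat) : rat :=
  let a := tnth v (inord 0) in
  let b := tnth v (inord 1) in
  let c := tnth v (inord 2) in
  (a%:R - b%:R) / c.+1%:R.

Definition Pi02_rat (S : set rat) : Prop := Pi02 (rat_of_triple @^-1` S).

Definition left_Pi02 (R : realType) (r : R) : Prop :=
  Pi02_rat [set q : rat | ratr q < r].

Definition D2 (R : realType) : set R :=
  [set r | exists a b : R, [/\ left_Pi02 a, left_Pi02 b & r = a - b]].

(* Only positive m is meaningful; the value at m = 0 does not affect limits. *)
Definition rho (R : realType) (X : set nat) (m : nat) : R :=
  #|[set j : 'I_m | val j \in X]%SET|%:R / m%:R.

Definition has_density (R : realType) (X : set nat) (r : R) : Prop :=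
  rho R X @ \oo --> r.

Definition n_ce_densities (R : realType) (n : nat) : set R :=
  [set r | exists2 A : set nat, n_ce n A & has_density A r].

Arguments D2 : clear implicits.
Arguments n_ce_densities : clear implicits.

(* Main.v *)
(* If g is an n-c.e. approximation to A, let U_m and V_m count the changes of
   g(j, .), j < m, from 0 to 1 and from 1 to 0. Then rho_m(A) = U_m/m - V_m/m,
   both terms are at most n, and both are left-c.e. uniformly in m. If rho_m(A)
   tends to r, then limsup U_m/m = r + limsup V_m/m, although neither sequence
   need converge; a limsup of uniformly left-c.e. reals is left-Pi_2.

   Conversely, let r = a - b < 1 and pick a rational c, b - (1 - r) < c < b, so
   that 0 < b - c and a - c < 1. Cut omega into the blocks [k^2, (k+1)^2), which
   are short compared with k^2. The i-th point of a block of length L = 2k+1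
   stands for the real c + i/L. It enters A once, for all rationals q <= c + i/L
   with a name below k, the Pi_2 condition "forall x exists y" expressing q < a
   has been verified for all x < k, and it leaves A for good when the same has
   happened for b. In the limit these events describe i/L < a - c and
   i/L < b - c, so the fraction of the block finally in A tends to r. *)

Require Import Defs.
From HB Require Import structures.
From mathcomp Require Import all_boot all_order all_algebra.
From mathcomp Require Import all_classical all_reals all_analysis.
From mathcomp Require Import zify ring lra.

Set Implicit Arguments.
Unset Strict Implicit.
Unset Printing Implicit Defensive.

Import Order.TTheory GRing.Theory Num.Theory.
Import numFieldNormedType.Exports.

Local Open Scope classical_set_scope.
Local Open Scope ring_scope.

(** * Closure properties of computable functions *)

Section Computability.

Local Open Scope nat_scope.

(** Arguments are read off a plain list, so that [nth] and [behead] can express variables without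
    dependent tuple types; only lists of length [k] matter. *)
Definition computes k (F : seq nat -> nat) : Prop :=
  computable (fun v : k.-tuple nat => F v).

Lemma computes_ext k (F G : seq nat -> nat) :
  (forall s, size s = k -> F s = G s) -> computes k F -> computes k G.
Proof.
move=> FG [c Hc]; exists c => v.
by have := Hc v; rewrite FG // size_tuple.
Qed.

Lemma computable_comp m k (f : m.-tuple nat -> nat)
    (h : 'I_m -> k.-tuple nat -> nat) :
  computable f -> (forall i, computable (h i)) ->
  computable (fun v => f [tuple h i v | i < m]).
Proof.
move=> [c Hc] /choice[d Hd]; exists (rcomp c d) => v /=.
exists [tuple h i v | i < m] => // i.
by rewrite tnth_mktuple; exact: Hd.
Qed.

Lemma computes_nth k i : computes k (nth 0 ^~ i).
Proof.
case: (ltnP i k) => ik.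
- exists (rproj (Ordinal ik)) => v /=.
  by rewrite (tnth_nth 0).
- exists (rzero k) => v /=.
  by rewrite nth_default // size_tuple.
Qed.

Lemma computes_cst k n : computes k (fun=> n).
Proof.
elim: n => [|n [c Hc]]; first by exists (rzero k).
exists (rcomp rsucc (fun=> c)) => v /=; exists [tuple n] => // i.
by rewrite (ord1 i); exact: Hc.
Qed.

Lemma computes_S k F : computes k F -> computes k (fun s => (F s).+1).
Proof.
move=> [c Hc]; exists (rcomp rsucc (fun=> c)) => v /=.
exists [tuple F v] => // i.
by rewrite (ord1 i); exact: Hc.
Qed.

(** The recursion is first run along a fresh leading argument, as [rprec] demands; composition then
    substitutes [B s] for that argument. *)
Lemma computes_rec k (B b : seq nat -> nat)
    (st : nat -> nat -> seq nat -> nat) :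
  computes k B -> computes k b ->
  computes k.+2 (fun s => st (nth 0 s 0) (nth 0 s 1) (behead (behead s))) ->
  computes k (fun s => iteri (B s) (fun t z => st t z s) (b s)).
Proof.
move=> HB [cb Hb] [cst Hst].
pose F (w : k.+1.-tuple nat) :=
  iteri (thead w) (fun t z => st t z (behead w)) (b (behead w)).
have HF : computable F.
  exists (rprec cb cst) => v /=; rewrite /F.
  elim: (thead v) => [|n IH] /=; first exact: (Hb (behead_tuple v)).
  eexists; first exact: IH.
  exact: (Hst (cons_tuple n (cons_tuple _ (behead_tuple v)))).
pose h (i : 'I_k.+1) (v : k.-tuple nat) := nth 0 (B v :: v) i.
have hc i : computable (h i).
  by case: i => -[|i] ik; [exact: HB | exact: (computes_nth k i)].
have [c Hc] := computable_comp HF hc; exists c => v.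
have := Hc v; rewrite /F.
have -> : [tuple h i v | i < k.+1] = cons_tuple (B v) v.
  by apply: eq_from_tnth => i; rewrite tnth_mktuple (tnth_nth 0).
by [].
Qed.

(** Under [m] nested bounded sums or quantifiers, an outer variable appears in exactly this form. *)
Lemma computes_leaf m k i : computes k (fun s => nth 0 (iter m behead s) i).
Proof.
apply: computes_ext (computes_nth k (m + i)) => s _.
by elim: m i => //= m IH i; rewrite nth_behead -IH addSnnS.
Qed.

Lemma computes_add k F G :
  computes k F -> computes k G -> computes k (fun s => F s + G s).
Proof.
move=> HF HG; apply: computes_ext (_ : computes k
  (fun s => iteri (F s) (fun _ z => z.+1) (G s))).
  by move=> s _; elim: (F s) => //= n ->.
apply: (@computes_rec k F G (fun _ z _ => z.+1)) => //.
exact/computes_S/computes_nth.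
Qed.

Lemma computes_sub k F G :
  computes k F -> computes k G -> computes k (fun s => F s - G s).
Proof.
have pred j H : computes j H -> computes j (fun s => (H s).-1).
  move=> HH; apply: computes_ext (_ : computes j
    (fun s => iteri (H s) (fun t _ => t) 0)).
    by move=> s _; case: (H s).
  apply: (@computes_rec j H (fun=> 0) (fun t _ _ => t)) => //.
    exact: computes_cst.
  exact: computes_nth.
move=> HF HG; apply: computes_ext (_ : computes k
  (fun s => iteri (G s) (fun _ z => z.-1) (F s))).
  by move=> s _; elim: (G s) => [|n /= ->]; rewrite ?subn0 // subnS.
apply: (@computes_rec k G F (fun _ z _ => z.-1)) => //.
exact/pred/computes_nth.
Qed.

Lemma computes_sum k (B : seq nat -> nat) (F : nat -> seq nat -> nat) :
  computes k.+1 (fun s => F (nth 0 s 0) (behead s)) -> computes k B ->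
  computes k (fun s => \sum_(0 <= i < B s) F i s).
Proof.
move=> HF HB; apply: computes_ext (_ : computes k
  (fun s => iteri (B s) (fun t z => z + F t s) 0)).
  by move=> s _; elim: (B s) => [|n /= ->];
    [rewrite big_geq | rewrite big_nat_recr].
apply: (@computes_rec k B (fun=> 0) (fun t z s => z + F t s)) => //.
  exact: computes_cst.
apply: computes_add; first exact: computes_nth.
(* The step function sees counter, accumulator, parameters; [h] skips the accumulator at position 1,
   which [F] does not take. *)
pose h (i : 'I_k.+1) (v : k.+2.-tuple nat) :=
  nth 0 v (if val i == 0 then 0 else i.+1).
have hc i : computable (h i) by exact: computes_nth.
have [c Hc] := computable_comp HF hc; exists c => v.
have := Hc v.
have -> // : [tuple h i v | i < k.+1] =
    cons_tuple (nth 0 v 0) (behead_tuple (behead_tuple v)).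
apply: eq_from_tnth => i; rewrite tnth_mktuple (tnth_nth 0) /h.
by case: i => -[|i] ik //=; rewrite !nth_behead.
Qed.

Lemma computes_mul k F G :
  computes k F -> computes k G -> computes k (fun s => F s * G s).
Proof.
move=> HF HG; apply: computes_ext (_ : computes k
  (fun s => iteri (F s) (fun _ z => G s + z) 0)).
  by move=> s _; elim: (F s) => //= n ->; rewrite mulSn.
apply: (@computes_rec k F (fun=> 0) (fun _ z s => G s + z)) => //.
  exact: computes_cst.
apply: computes_add; last exact: computes_nth.
pose h (i : 'I_k) (v : k.+2.-tuple nat) := nth 0 v i.+2.
have hc i : computable (h i) by exact: computes_nth.
have [c Hc] := computable_comp HG hc; exists c => v.
have := Hc v.
have -> // : [tuple h i v | i < k] = behead_tuple (behead_tuple v).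
apply: eq_from_tnth => i; rewrite tnth_mktuple (tnth_nth 0) /h.
by rewrite !nth_behead.
Qed.

Lemma computes_leq k F G :
  computes k F -> computes k G -> computes k (fun s => F s <= G s).
Proof.
move=> HF HG; apply: computes_ext (_ : computes k (fun s => 1 - (F s - G s))).
  by move=> s _; rewrite -subn_eq0; case: (F s - G s).
by apply: computes_sub; [exact: computes_cst | exact: computes_sub].
Qed.

Lemma computes_negb k (F : seq nat -> bool) :
  computes k F -> computes k (fun s => ~~ F s).
Proof.
move=> HF; apply: computes_ext (_ : computes k (fun s => 1 - F s)).
  by move=> s _; case: (F s).
by apply: computes_sub => //; exact: computes_cst.
Qed.

Lemma computes_andb k (F G : seq nat -> bool) :
  computes k F -> computes k G -> computes k (fun s => F s && G s).
Proof.
move=> HF HG; apply: computes_ext (computes_mul HF HG) => s _.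
by rewrite mulnb.
Qed.

Lemma computes_orb k (F G : seq nat -> bool) :
  computes k F -> computes k G -> computes k (fun s => F s || G s).
Proof.
move=> HF HG; apply: computes_ext (_ : computes k
  (fun s => ~~ (~~ F s && ~~ G s))).
  by move=> s _; rewrite -negb_or negbK.
by apply: computes_negb; apply: computes_andb; exact: computes_negb.
Qed.

Lemma computes_has k (B : seq nat -> nat) (P : nat -> seq nat -> bool) :
  computes k.+1 (fun s => P (nth 0 s 0) (behead s)) -> computes k B ->
  computes k (fun s => has (fun i => P i s) (iota 0 (B s))).
Proof.
move=> HP HB; apply: computes_ext (_ : computes k
  (fun s => 0 < \sum_(0 <= i < B s) P i s)).
  move=> s _; congr nat_of_bool.
  rewrite /index_iota subn0; elim: (iota _ _) => [|i l IH] /=.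
    by rewrite big_nil.
  by rewrite big_cons addn_gt0 IH; case: (P i s).
by apply: computes_leq; [exact: computes_cst | exact: computes_sum].
Qed.

Lemma computes_all k (B : seq nat -> nat) (P : nat -> seq nat -> bool) :
  computes k.+1 (fun s => P (nth 0 s 0) (behead s)) -> computes k B ->
  computes k (fun s => all (fun i => P i s) (iota 0 (B s))).
Proof.
move=> HP HB; apply: computes_ext (_ : computes k
  (fun s => ~~ has (fun i => ~~ P i s) (iota 0 (B s)))).
  by move=> s _; rewrite has_predC negbK.
apply: computes_negb; apply: (computes_has (P := fun i s => ~~ P i s)) => //.
exact: computes_negb HP.
Qed.

Lemma computes_apply2 k (f : nat -> nat -> nat) F0 F1 :
  computes 2 (fun s => f (nth 0 s 0) (nth 0 s 1)) ->
  computes k F0 -> computes k F1 -> computes k (fun s => f (F0 s) (F1 s)).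
Proof.
move=> Hf H0 H1.
pose h (i : 'I_2) (v : k.-tuple nat) := nth 0 [:: F0 v; F1 v] i.
have hc i : computable (h i) by case: i => -[|[|]].
have [c Hc] := computable_comp Hf hc; exists c => v; have := Hc v.
have -> // : [tuple h i v | i < 2] = [tuple F0 v; F1 v].
by apply: eq_from_tnth => i; rewrite tnth_mktuple (tnth_nth 0).
Qed.

Lemma computes_apply5 k (f : nat -> nat -> nat -> nat -> nat -> nat)
    F0 F1 F2 F3 F4 :
  computes 5 (fun s =>
    f (nth 0 s 0) (nth 0 s 1) (nth 0 s 2) (nth 0 s 3) (nth 0 s 4)) ->
  computes k F0 -> computes k F1 -> computes k F2 -> computes k F3 ->
  computes k F4 -> computes k (fun s => f (F0 s) (F1 s) (F2 s) (F3 s) (F4 s)).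
Proof.
move=> Hf H0 H1 H2 H3 H4.
pose h (i : 'I_5) (v : k.-tuple nat) :=
  nth 0 [:: F0 v; F1 v; F2 v; F3 v; F4 v] i.
have hc i : computable (h i) by case: i => -[|[|[|[|[|]]]]].
have [c Hc] := computable_comp Hf hc; exists c => v; have := Hc v.
have -> // : [tuple h i v | i < 5] = [tuple F0 v; F1 v; F2 v; F3 v; F4 v].
by apply: eq_from_tnth => i; rewrite tnth_mktuple (tnth_nth 0).
Qed.

End Computability.

Ltac computes_step :=
  cbv beta;
  lazymatch goal with
  | |- computes _ (fun s => nat_of_bool (leq _ _)) => apply: computes_leq
  | |- computes _ (fun s => nat_of_bool (negb _)) => apply: computes_negb
  | |- computes _ (fun s => nat_of_bool (andb _ _)) => apply: computes_andb
  | |- computes _ (fun s => nat_of_bool (orb _ _)) => apply: computes_orb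
  | |- computes _ (fun s => nat_of_bool (has _ _)) => apply: computes_has
  | |- computes _ (fun s => nat_of_bool (all _ _)) => apply: computes_all
  | |- computes _ (fun s => addn _ _) => apply: computes_add
  | |- computes _ (fun s => subn _ _) => apply: computes_sub
  | |- computes _ (fun s => muln _ _) => apply: computes_mul
  | |- computes _ (fun s => S _) => apply: computes_S
  | |- computes _ (fun s => bigop.body _ _ _) => apply: computes_sum
  | |- computes _ (fun s => nth _ _ _) =>
      first [ exact: computes_nth | exact: (computes_leaf 1)
            | exact: (computes_leaf 2) | exact: (computes_leaf 3)
            | exact: (computes_leaf 4) | exact: (computes_leaf 5)
            | exact: (computes_leaf 6) ]
  | |- computes _ (fun s => _) => first [exact: computes_cst | eassumption]
  end.

Ltac computes_tac := repeat computes_step.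

(** * Left-Pi_2 reals *)

(** The real value of the rational that [rat_of_triple] assigns to the name [(p, n, d)]. *)
Definition nratio (R : realType) (p n d : nat) : R := (p%:R - n%:R) / d.+1%:R.

Section Ratio.
Variable R : realType.
Implicit Types a : R.

Lemma ratr_nratio (p n d : nat) :
  ratr ((p%:R - n%:R) / d.+1%:R : rat) = nratio R p n d.
Proof. by rewrite rmorphM rmorphB fmorphV !rmorph_nat. Qed.

Lemma nratio_surj (q : rat) : exists p n d, ratr q = nratio R p n d.
Proof.
have [d dq] : exists d, denq q = d.+1%:Z.
  by case: (denq q) (denq_gt0 q) => [[|d]|d] // _; exists d.
have [p [n pn]] : exists p n : nat, numq q = p%:Z - n%:Z.
  case: (numq q) => [p|n]; first by exists p, 0%N; rewrite subr0.
  by exists 0%N, n.+1; rewrite sub0r NegzE.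
by exists p, n, d; rewrite /ratr dq pn /nratio rmorphB.
Qed.

Lemma nratio_between (x y : R) : x < y -> exists p n d, x < nratio R p n d < y.
Proof.
move=> /rat_in_itvoo[q]; rewrite in_itv /= => xqy.
by have [p [n [d e]]] := nratio_surj q; exists p, n, d; rewrite -e.
Qed.

Lemma ler_nratio (p n d p' n' d' : nat) :
  (nratio R p n d <= nratio R p' n' d') =
  (p * d'.+1 + n' * d.+1 <= p' * d.+1 + n * d'.+1)%N.
Proof.
rewrite /nratio ler_pdivrMr// mulrAC ler_pdivlMr// -(ler_nat R) !natrD !natrM.
rewrite !mulrBl -[LHS]subr_ge0 -[RHS]subr_ge0; congr (_ <= _).
ring.
Qed.

Lemma left_Pi02P a : left_Pi02 a <->
  exists2 g : nat -> nat -> nat -> nat -> nat -> bool,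
    computes 5 (fun s =>
      g (nth 0 s 0) (nth 0 s 1) (nth 0 s 2) (nth 0 s 3) (nth 0 s 4))%N &
    forall p n d, nratio R p n d < a <-> forall x, exists y, g x y p n d.
Proof.
have ratrE (v : 3.-tuple nat) : ratr (rat_of_triple v) =
    nratio R (nth 0 v 0)%N (nth 0 v 1)%N (nth 0 v 2)%N.
  rewrite /rat_of_triple /nratio !(tnth_nth 0%N) !inordK//.
  exact: ratr_nratio.
split=> [[g cg gP]|[g cg gP]].
- exists (fun x y p n d => g [tuple x; y; p; n; d]).
    have [c Hc] := cg; exists c => v; have := Hc v.
    have {1 3}-> // : v =
        [tuple nth 0 v 0; nth 0 v 1; nth 0 v 2; nth 0 v 3; nth 0 v 4]%N.
    by apply: eq_from_tnth => -[[|[|[|[|[|]]]]]// i5]; rewrite !(tnth_nth 0%N).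
  move=> p n d; have := gP [tuple p; n; d].
  rewrite /= ratrE /= => ->.
  have e x y : g (cons_tuple x (cons_tuple y [tuple p; n; d])) =
      g [tuple x; y; p; n; d] by congr g; exact: val_inj.
  by split=> H x; have [y gy] := H x; exists y; rewrite ?e // -e.
- exists (fun w =>
      g (nth 0 w 0) (nth 0 w 1) (nth 0 w 2) (nth 0 w 3) (nth 0 w 4))%N.
    exact: cg.
  by move=> v; rewrite /= ratrE gP.
Qed.

(** A finite limsup by its two defining inequalities. The clause [0 < m] keeps the index usable as a
    denominator, since [u m] will be a quotient by [m]. *)
Definition is_limsup (u : nat -> R) a : Prop :=
  (forall e N, 0 < e -> exists m, [/\ (N <= m)%N, (0 < m)%N & a - e < u m]) /\
  (forall e, 0 < e -> exists N, forall m, (N <= m)%N -> u m <= a + e).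

(** The limsup is the supremum of the reals that [u] reaches or exceeds at arbitrarily large
    indices. *)
Lemma limsup_exists (u : nat -> R) B :
  (forall m, 0 <= u m <= B) -> exists a, is_limsup u a.
Proof.
move=> uB.
pose S := [set x : R | forall N, exists m,
  [/\ (N <= m)%N, (0 < m)%N & x <= u m]].
have S0 : S 0 by move=> N; exists N.+1; split=> //; case/andP: (uB N.+1).
have hS : has_sup S.
  split; first by exists 0.
  exists B => x /(_ 0%N)[m [_ _ xm]]; apply: le_trans xm _.
  by case/andP: (uB m).
exists (sup S); split=> [e N e0|e e0].
  have [x Sx xe] := sup_adherent e0 hS.
  by have [m [Nm m0 xm]] := Sx N; exists m; split=> //; exact: lt_le_trans xm.
have : ~ S (sup S + e).
  by move=> /(ub_le_sup hS.2); rewrite leNgt ltrDl e0.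
move=> /existsNP[N HN]; exists N.+1 => m Nm.
rewrite leNgt; apply/negP => um; apply: HN; exists m.
split=> //; last exact: ltW.
- exact: ltnW.
- exact: leq_ltn_trans Nm.
Qed.

(** For large [m], [v m] is within [e / 2] of [u m - r], so both inequalities transfer. Only the
    difference has to converge. *)
Lemma limsup_shift (u v : nat -> R) a r :
  is_limsup u a -> (u m - v m) @[m --> \oo] --> r -> is_limsup v (a - r).
Proof.
move=> [Hl Hu] /cvgrPdist_le cv; split=> [e N e0|e e0].
- have e2 : 0 < e / 2 by lra.
  have [N' _ HN'] := cv _ e2.
  have [m [Nm m0 um]] := Hl _ (maxn N N') e2.
  exists m; split=> //; first by lia.
  have := HN' m; rewrite /= => /(_ ltac:(lia)).
  by rewrite ler_distl => /andP[]; lra.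
- have e2 : 0 < e / 2 by lra.
  have [N' _ HN'] := cv _ e2.
  have [N um] := Hu _ e2.
  exists (maxn N N') => m Nm; have := um m ltac:(lia).
  have := HN' m; rewrite /= => /(_ ltac:(lia)).
  by rewrite ler_distl => /andP[]; lra.
Qed.

(** For irrational [a], [q < a] holds iff for every [x] there are a positive [m >= x] and a stage
    [t] with [q - 1/(x+1) < U m t / m]. Since [U m] increases to [Uoo m] and attains it, the
    existence of such a stage is equivalent to the same inequality for [Uoo m]. *)
Lemma left_Pi02_limsup (U : nat -> nat -> nat) (Uoo : nat -> nat) a :
  computes 2 (fun s => U (nth 0 s 0) (nth 0 s 1))%N ->
  (forall m, {homo U m : s t / (s <= t)%N}) ->
  (forall m t, (U m t <= Uoo m)%N) ->
  (forall m, exists t, U m t = Uoo m) ->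
  is_limsup (fun m => (Uoo m)%:R / m%:R) a -> left_Pi02 a.
Proof.
move=> cU homoU leU Uex [Hl Hu]; apply/left_Pi02P.
have [[q aq]|nq] := pselect (exists q : rat, a = ratr q).
- (* The test below cannot separate [q < a] from [q <= a], so it needs [a]
     irrational; the cut of a rational is decidable. *)
  have [p [n [d e]]] := nratio_surj q.
  exists (fun _ _ p' n' d' =>
    ~~ (p * d'.+1 + n' * d.+1 <= p' * d.+1 + n * d'.+1))%N.
    by computes_tac.
  move=> p' n' d'; rewrite aq e ltNge ler_nratio.
  by split=> [H x|/(_ 0%N)[y]//]; exists 0%N.
- (* [y] bounds both the index [m] and the stage, which avoids pairing. *)
  exists (fun x y p n d => has (fun m => [&& x <= m, 0 < m & p * m * x.+1 <
      U m y * d.+1 * x.+1 + n * m * x.+1 + m * d.+1]) (iota 0 y))%N.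
    computes_tac.
    by apply: (@computes_apply2 _ U) => //; computes_tac.
  move=> p n d.
  (* The decidable test is the real inequality with its denominators cleared and the negative terms
     moved across. *)
  have key m x k : (0 < m)%N ->
      (p * m * x.+1 < k * d.+1 * x.+1 + n * m * x.+1 + m * d.+1)%N =
      (nratio R p n d - x.+1%:R^-1 < k%:R / m%:R).
    move=> m0; rewrite /nratio ltr_pdivlMr ?ltr0n//.
    have d0 : 0 < d.+1%:R :> R by rewrite ltr0n.
    have x0 : 0 < x.+1%:R :> R by rewrite ltr0n.
    rewrite -[RHS](ltr_pM2r (mulr_gt0 d0 x0)) -(ltr_nat R) !natrD !natrM.
    rewrite -[LHS]subr_gt0 -[RHS]subr_gt0; congr (_ < _).
    by field; rewrite !gt_eqF.
  split=> [qa x|H].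
  + have qa0 : 0 < a - nratio R p n d by rewrite subr_gt0.
    have [m [xm m0]] := Hl _ x qa0; rewrite subKr => um.
    have [t tE] := Uex m; exists (maxn m.+1 t); apply/hasP; exists m.
      by rewrite mem_iota /=; lia.
    rewrite xm m0 key //=.
    have -> : U m (maxn m.+1 t) = Uoo m.
      apply/eqP; rewrite eqn_leq leU -tE homoU//; lia.
    apply: le_lt_trans um.
    by rewrite lerBlDr lerDl invr_ge0.
  + have : nratio R p n d <= a.
      apply/ler_addgt0Pr => e e0.
      have [N HN] := Hu (e / 2) ltac:(lra).
      have [M HM] : exists M, M.+1%:R^-1 < e / 2 :> R.
        have [M] := ltr_add_invr (y := 0) (x := e/2) ltac:(lra).
        by rewrite add0r; exists M.
      (* This [x] serves twice: [m >= N] gives the upper bound of the limsup, and [x >= M] makes the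
         slack [1/(x+1)] less than [e / 2]. *)
      have [y /hasP[m _ /and3P[xm m0]]] := H (maxn N M).
      rewrite key// => lt1.
      have /= := HN m ltac:(lia).
      have : (U m y)%:R / m%:R <= (Uoo m)%:R / m%:R :> R.
        by rewrite ler_pM2r ?invr_gt0 ?ltr0n// ler_nat.
      have : (maxn N M).+1%:R^-1 <= M.+1%:R^-1 :> R.
        by rewrite lef_pV2 ?posrE ?ltr0n// ler_nat ltnS leq_maxr.
      move: lt1 HM; move: (_^-1) ((U m y)%:R / m%:R) ((Uoo m)%:R / m%:R).
      by move: (M.+1%:R^-1) => i1 i2 i3 i4; lra.
    rewrite le_eqVlt => /predU1P[pa|//]; exfalso; apply: nq.
    exists ((p%:R - n%:R) / d.+1%:R).
    by rewrite -pa ratr_nratio.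
Qed.

End Ratio.

(** * The density of an n-c.e. set *)

Section NceDensity.
Local Open Scope card_scope.
Variable R : realType.

Lemma rhoE (A : set nat) m :
  rho R A m = (\sum_(0 <= j < m) (j \in A))%:R / m%:R.
Proof.
rewrite /rho big_mkord -big_mkcond /= sum1_card.
by congr (_%:R / _); apply: eq_card => i; rewrite inE.
Qed.

Lemma sum_bool_le (P : nat -> bool) m :
  (\sum_(0 <= j < m) P j <= m)%N.
Proof.
rewrite -[leqRHS]muln1 -[X in (_ <= X * _)%N]subn0 -sum_nat_const_nat.
by rewrite leq_sum// => i _; exact: leq_b1.
Qed.

Lemma rho_itv (A : set nat) m : 0 <= rho R A m <= 1.
Proof.
rewrite rhoE divr_ge0 ?ler0n//=.
have [->|m0] := posnP m; first by rewrite invr0 mulr0.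
by rewrite ler_pdivrMr ?ltr0n// mul1r ler_nat sum_bool_le.
Qed.

Lemma density_itv (A : set nat) (r : R) : has_density A r -> 0 <= r <= 1.
Proof.
move=> /cvgrPdist_le H; apply/andP; split; apply/ler_addgt0Pr => e e0;
  have [N _ /(_ N (leqnn N))] := H e e0;
  by rewrite ler_distl; have /andP[] := rho_itv A N; lra.
Qed.

(** The stages counted form a duplicate-free list, which an injection of [S] sends into [iota 0 n].
    This turns the cardinality bound on mind changes into a bound on a sum. *)
Lemma card_le_sum (S : set nat) n (P : nat -> bool) t :
  (forall s, P s -> S s) -> S #<= `I_n -> (\sum_(0 <= s < t) P s <= n)%N.
Proof.
move=> PS /pcard_leP[f].
rewrite -big_mkcond sum1_count -size_filter /index_iota subn0.
set l := seq.filter _ _.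
have lS s : s \in l -> S s by rewrite mem_filter => /andP[/PS].
rewrite -(size_map f l) -[leqRHS](size_iota 0 n); apply: uniq_leq_size.
  rewrite map_inj_in_uniq ?filter_uniq ?iota_uniq//.
  by move=> x y /lS Sx /lS Sy; apply: inj; rewrite inE.
move=> _ /mapP[s /lS Ss ->]; rewrite mem_iota /=.
exact: (@funS _ _ _ _ f _ Ss).
Qed.

Definition transitions (P : nat -> nat -> bool) (m t : nat) : nat :=
  (\sum_(0 <= j < m) \sum_(0 <= s < t) P j s)%N.

Lemma transitions_homo P m : {homo transitions P m : s t / (s <= t)%N}.
Proof.
move=> s t st; apply: leq_sum => j _.
by rewrite [leqRHS](@big_cat_nat _ _ _ s)//= leq_addr.
Qed.

Lemma transitions_stable P m T :
  (forall j s, (j < m)%N -> (T <= s)%N -> P j s = false) ->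
  forall t, (transitions P m t <= transitions P m T)%N.
Proof.
move=> H t; have [tT|Tt] := leqP t T; first exact: transitions_homo.
rewrite /transitions big_nat [leqRHS]big_nat; apply: leq_sum => j /= jm.
rewrite (@big_cat_nat _ _ _ T) ?(ltnW Tt)//= -[leqRHS]addn0 leq_add2l leqn0.
rewrite big_nat big1 // => s /andP[Ts _].
by rewrite H.
Qed.

Lemma D2_of_density n (A : set nat) (r : R) :
  n_ce n A -> has_density A r -> D2 R r.
Proof.
move=> [g [cg g0 glim gch]] rA.
have {}cg : computes 2 (fun s => g (nth 0 s 0) (nth 0 s 1))%N.
  case: cg => c Hc; exists c => v; have := Hc v.
  by rewrite !(tnth_nth 0%N).
pose up j s := ~~ g j s && g j s.+1.
pose dn j s := g j s && ~~ g j s.+1.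
have bnd (P : nat -> nat -> bool) m t :
    (forall j s, P j s -> g j s != g j s.+1) ->
    (transitions P m t <= n * m)%N.
  move=> Pg; rewrite /transitions mulnC -[X in (_ <= X * _)%N]subn0.
  rewrite -sum_nat_const_nat leq_sum// => j _.
  by apply: card_le_sum (gch j) => s; exact: Pg.
have upg j s : up j s -> g j s != g j s.+1.
  by rewrite /up; case: (g j s) (g j s.+1) => -[].
have dng j s : dn j s -> g j s != g j s.+1.
  by rewrite /dn; case: (g j s) (g j s.+1) => -[].
(* Rises minus falls telescope to the current value because [g j 0] is false. *)
have tele j t : (\sum_(0 <= s < t) up j s =
    \sum_(0 <= s < t) dn j s + g j t)%N.
  elim: t => [|t IH]; first by rewrite !big_geq// g0.
  rewrite !big_nat_recr//= IH /up /dn.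
  by case: (g j t) (g j t.+1) => -[]; lia.
have /choice[T HT] : forall j, exists t, forall s, (t <= s)%N ->
    g j s = (j \in A).
  by move=> j; have [t _ Ht] := glim j; exists t => s /Ht.
(* The sum dominates each settling time [T j], so by stage [TT m] the approximation is final at
   every [j < m]. *)
pose TT m := (\sum_(0 <= j < m) T j)%N.
have TTle m j : (j < m)%N -> (T j <= TT m)%N.
  move=> jm; rewrite /TT big_mkord (bigD1 (Ordinal jm))//= leq_addr//.
have st (P : nat -> nat -> bool) m : (forall j s, P j s -> g j s != g j s.+1) ->
    forall j s, (j < m)%N -> (TT m <= s)%N -> P j s = false.
  move=> Pg j s jm ms; apply: contraTF isT => /Pg.
  have Ts := leq_trans (TTle m j jm) ms.
  by rewrite !HT ?eqxx// (leq_trans Ts).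
pose U m := transitions up m (TT m).
pose V m := transitions dn m (TT m).
have UV m : (U m)%:R / m%:R - (V m)%:R / m%:R = rho R A m.
  have -> : U m = (V m + \sum_(0 <= j < m) (j \in A))%N.
    rewrite /U /V /transitions -big_split/= big_nat [RHS]big_nat.
    by apply: eq_bigr => j /= jm; rewrite tele (HT j (TT m))// TTle.
  by rewrite natrD mulrDl addrC addrA addNr add0r rhoE.
have [a Ha] : exists a, is_limsup (fun m => (U m)%:R / m%:R : R) a.
  apply: (@limsup_exists _ _ n%:R) => m; rewrite divr_ge0//=.
  have [->|m0] := posnP m; first by rewrite invr0 mulr0.
  by rewrite ler_pdivrMr ?ltr0n// -natrM ler_nat bnd.
have Hb : is_limsup (fun m => (V m)%:R / m%:R : R) (a - r).
  apply: limsup_shift Ha _.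
  by under eq_fun do rewrite UV.
have cP (P : nat -> nat -> bool) :
    computes 2 (fun s => P (nth 0 s 0) (nth 0 s 1))%N ->
    computes 2 (fun s => transitions P (nth 0 s 0) (nth 0 s 1))%N.
  move=> cP; rewrite /transitions; computes_tac.
  by apply: (@computes_apply2 _ P) => //; computes_tac.
exists a, (a - r); split; last by rewrite subKr.
- apply: (left_Pi02_limsup (U := transitions up)) Ha.
  + apply: cP; rewrite /up; computes_tac => //.
    by apply: (@computes_apply2 _ g) => //; computes_tac.
  + exact: transitions_homo.
  + by move=> m; apply: transitions_stable; exact: st.
  + by move=> m; exists (TT m).
- apply: (left_Pi02_limsup (U := transitions dn)) Hb.
  + apply: cP; rewrite /dn; computes_tac => //.
    by apply: (@computes_apply2 _ g) => //; computes_tac.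
  + exact: transitions_homo.
  + by move=> m; apply: transitions_stable; exact: st.
  + by move=> m; exists (TT m).
Qed.

End NceDensity.

(** * Realizing a difference of left-Pi_2 reals *)

Section SquareBlocks.
Local Open Scope nat_scope.

(** The floor of the square root, written as a bounded count of positive squares so that its
    computability is immediate. *)
Definition isqrt (x : nat) : nat := \sum_(0 <= j < x) (j.+1 * j.+1 <= x).

Lemma isqrtE k i : i < k.*2.+1 -> isqrt (k * k + i) = k.
Proof.
move=> ik; rewrite /isqrt (@big_cat_nat _ _ _ k) ?nia//=; last nia.
rewrite big_nat (eq_bigr (fun=> 1)) => [|j /= jk]; last first.
  by have -> : j.+1 * j.+1 <= k * k + i by nia.
rewrite -big_nat sum_nat_const_nat subn0 muln1 big_nat big1 ?addn0//.
by move=> j /andP[kj _]; apply/eqP; rewrite eqb0 -ltnNge; nia.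
Qed.

Lemma square_block m : exists k i, m = k * k + i /\ i < k.*2.+1.
Proof.
elim: m => [|m [k [i [-> ik]]]]; first by exists 0, 0.
have [ilt|ige] := ltnP i k.*2.
  by exists k, i.+1; split; rewrite ?addnS// ltnS.
by exists k.+1, 0; split=> //; nia.
Qed.

Lemma computes_isqrt k F : computes k F -> computes k (fun s => isqrt (F s)).
Proof.
move=> cF.
have c1 : computes 1 (fun s => isqrt (nth 0 s 0)).
  by rewrite /isqrt; computes_tac.
have [c Hc] := computable_comp c1 (fun _ : 'I_1 => cF); exists c => v.
have := Hc v; have -> // : [tuple F v | _ < 1] = [tuple F v].
by apply: eq_from_tnth => i; rewrite tnth_mktuple (tnth_nth 0) (ord1 i).
Qed.

End SquareBlocks.

(** * Density from counts in square blocks *)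

Section Counting.
Variable R : realType.

(** For [y] in [[0, L]] the count is the ceiling of [y]; this lemma and the next one keep it between
    [y] and [y + 1]. *)
Lemma count_below_ge (y : R) L : y <= L%:R ->
  y <= (\sum_(0 <= i < L) (i%:R < y)%R)%:R.
Proof.
elim: L => [|L IH] yL; first by rewrite big_geq.
have [yL'|Ly] := leP y L%:R.
  apply: le_trans (IH yL') _.
  by rewrite ler_nat big_nat_recr//= leq_addr.
apply: le_trans yL _; rewrite ler_nat -[leqLHS]subn0 -[leqLHS]muln1.
rewrite -sum_nat_const_nat big_nat [leqRHS]big_nat leq_sum// => i /= iL.
by rewrite lt0b (le_lt_trans _ Ly)// ler_nat.
Qed.

Lemma count_below_le (y : R) L : 0 <= y ->
  (\sum_(0 <= i < L) (i%:R < y)%R)%:R <= y + 1.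
Proof.
move=> y0; elim: L => [|L IH]; first by rewrite big_geq// addr_ge0.
rewrite big_nat_recr//=; have [Ly|yL] := ltP L%:R y; last by rewrite addn0.
rewrite natrD lerD2r; apply: le_trans (ltW Ly); rewrite ler_nat.
exact: sum_bool_le.
Qed.

(** The deviation [D m] of the count from [r m] adds up over blocks: at [k^2] it is at most
    [K^2 + (e/2) k^2 + k], and a partial last block adds at most [2k]. All but the middle term is
    negligible against [m >= k^2]. *)
Lemma square_blocks_density (X : nat -> bool) (r : R) : 0 <= r <= 1 ->
  (forall e, 0 < e -> exists K, forall k, (K <= k)%N ->
    `|(\sum_(0 <= i < k.*2.+1) X (k * k + i)%N)%:R - r * k.*2.+1%:R|
      <= e * k.*2.+1%:R + 1) ->
  (\sum_(0 <= j < m) X j)%:R / m%:R @[m --> \oo] --> r.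
Proof.
move=> /andP[r0 r1] HX; apply/cvgrPdist_le => e e0.
pose D m : R := (\sum_(0 <= j < m) X j)%:R - r * m%:R.
(* Each step changes [D] by [0 - r] or [1 - r], of absolute value at most 1 as [r] lies in
   [[0, 1]]. *)
have Dincr m i : `|D (m + i)%N| <= `|D m| + i%:R.
  elim: i => [|i IH]; first by rewrite addn0 addr0.
  have -> : D (m + i.+1)%N = D (m + i)%N + ((X (m + i)%N)%:R - r).
    by rewrite /D addnS big_nat_recr//= natrD -[(m + i).+1]addn1 natrD; ring.
  apply: le_trans (ler_normD _ _) _; rewrite -natr1 addrA lerD//.
  by rewrite ler_norml; case: (X _) => /=; lra.
have Dle m : `|D m| <= m%:R.
  have D0 : D 0%N = 0 by rewrite /D big_geq// mulr0 subrr.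
  by have := Dincr 0%N m; rewrite D0 normr0 add0r.
have e2 : 0 < e / 2 by lra.
have [K HK] := HX _ e2.
have Dsq k : `|D (k * k)%N| <= (K * K)%:R + e / 2 * (k * k)%:R + k%:R.
  elim: k => [|k IH].
    by apply: le_trans (Dle _) _; rewrite mul0n mulr0 !addr0.
  have [kK|Kk] := leqP k.+1 K.
    apply: le_trans (Dle _) _; rewrite -addrA ler_wpDr//.
      by rewrite addr_ge0// mulr_ge0// ltW.
    by rewrite ler_nat leq_mul.
  have -> : D (k.+1 * k.+1)%N = D (k * k)%N +
      ((\sum_(0 <= i < k.*2.+1) X (k * k + i)%N)%:R - r * k.*2.+1%:R).
    have -> : (k.+1 * k.+1 = k * k + k.*2.+1)%N by nia.
    rewrite /D (@big_cat_nat _ _ _ (k * k)%N) ?leq_addr//= !natrD.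
    rewrite -{2}[(k * k)%N]add0n big_addn addKn.
    by under [in X in _ + X - _]eq_bigr do rewrite addnC; ring.
  apply: le_trans (ler_normD _ _) _.
  apply: le_trans (lerD IH (HK k Kk)) _.
  have -> : (k.+1 * k.+1 = k * k + k.*2.+1)%N by nia.
  by rewrite natrD -[k.+1%:R]natr1; lra.
(* For [k > M] and [i <= 2k], the error [K^2 + k + i] is at most [(K^2 + 3) k], hence at most
   [(e/2) k^2]. *)
have [M HM] : exists M : nat, (K * K)%:R + 3 < M%:R * (e / 2).
  have := archi_boundP (x := ((K * K)%:R + 3) / (e / 2)).
  rewrite divr_ge0 ?addr_ge0 ?(ltW e2)// => /(_ isT).
  by rewrite ltr_pdivrMr//; exists (Num.bound (((K * K)%:R + 3) / (e / 2))).
exists (M.+1 * M.+1)%N => // m /= Mm.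
have m0 : 0 < m%:R :> R by rewrite ltr0n; lia.
have -> : r - (\sum_(0 <= j < m) X j)%:R / m%:R = - (D m / m%:R).
  by rewrite /D; field; rewrite gt_eqF.
rewrite normrN normrM normfV (gtr0_norm m0) ler_pdivrMr//.
have [k [i [mE ik]]] := square_block m.
have Mk : (M < k)%N by rewrite mE in Mm; nia.
rewrite mE; apply: le_trans (Dincr _ _) _.
apply: le_trans (lerD (Dsq k) (lexx _)) _.
have i2 : i%:R <= 2 * k%:R :> R by rewrite -natrM ler_nat; lia.
have k1 : 1 <= k%:R :> R by rewrite ler1n; lia.
have kM : M%:R <= k%:R :> R by rewrite ler_nat ltnW.
have i0 : 0 <= i%:R :> R by [].
have KK0 : 0 <= (K * K)%:R :> R by [].
rewrite natrD [(k * k)%:R]natrM.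
move: i2 k1 kM i0 KK0 HM; move: (k%:R) (i%:R) ((K * K)%:R) (M%:R) => x y z w.
move=> y2 x1 wx y0 z0 zw.
have : z + 3 <= x * (e / 2).
  by apply: ltW; apply: lt_le_trans zw _; rewrite ler_pM2r.
nra.
Qed.

End Counting.

(** * Finite approximations to a left-Pi_2 cut *)

Section Construction.

(** The inequality [q <= c + i/(2k+1)] cleared of denominators and subtractions, where [(p, n, d)]
    names [q] and [(p0, n0, d0)] names [c]; see [belowE]. *)
Definition below (p0 n0 d0 k i p n d : nat) : bool :=
  (p * (k + k).+1 * d0.+1 + n0 * d.+1 * (k + k).+1
   <= i * d.+1 * d0.+1 + p0 * d.+1 * (k + k).+1 + n * (k + k).+1 * d0.+1)%N.

(** Bounding names and [x] by [k] leaves finitely many searches, so a point below the cut passes at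
    a finite stage; as [k] grows, every fixed failure is eventually tested. *)
Definition passes (g : nat -> nat -> nat -> nat -> nat -> bool)
    (p0 n0 d0 k i s : nat) : bool :=
  all (fun p => all (fun n => all (fun d =>
    ~~ below p0 n0 d0 k i p n d ||
    all (fun x => has (fun y => g x y p n d) (iota 0 s)) (iota 0 k))
  (iota 0 k)) (iota 0 k)) (iota 0 k).

Lemma all_iotaP (P : nat -> bool) k :
  reflect (forall j, (j < k)%N -> P j) (all P (iota 0 k)).
Proof.
apply: (iffP allP) => H j; first by move=> jk; apply: H; rewrite mem_iota.
by rewrite mem_iota => /H.
Qed.

Definition persistent (b : nat -> bool) := forall s t, (s <= t)%N -> b s -> b t.

Lemma persistent_all k (P : nat -> nat -> bool) :
  (forall j, persistent (P j)) -> persistent (fun s => all (P^~ s) (iota 0 k)).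
Proof. by move=> mP s t st; apply: sub_all => j; exact: mP. Qed.

Lemma eventually_all k (P : nat -> nat -> bool) :
  (forall j, persistent (P j)) -> (forall j, (j < k)%N -> exists s, P j s) ->
  exists s, all (P^~ s) (iota 0 k).
Proof.
move=> mP; elim: k => [|k IH] exP; first by exists 0%N.
have [s1 /all_iotaP H1] := IH (fun j jk => exP j (leqW jk)).
have [s2 H2] := exP k (leqnn _).
exists (maxn s1 s2); apply/all_iotaP => j; rewrite ltnS leq_eqVlt.
move=> /predU1P[->|jk]; first exact: mP (leq_maxr _ _) H2.
exact: mP (leq_maxl _ _) (H1 j jk).
Qed.

Lemma persistent_or (b : bool) (P : nat -> bool) :
  persistent P -> persistent (fun s => b || P s).
Proof. by move=> mP s t st; case: b => //=; exact: mP. Qed.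

Lemma persistent_has (P : nat -> bool) : persistent (fun s => has P (iota 0 s)).
Proof.
move=> s t st /hasP[y]; rewrite mem_iota => /= ys Py.
apply/hasP; exists y => //.
by rewrite mem_iota /= (leq_trans ys).
Qed.

Lemma persistent_passes g p0 n0 d0 k i : persistent (passes g p0 n0 d0 k i).
Proof.
do 3 (apply: persistent_all => ?); apply: persistent_or.
by apply: persistent_all => ?; exact: persistent_has.
Qed.

Section Cut.
Variables (R : realType) (a : R) (g : nat -> nat -> nat -> nat -> nat -> bool).
Variables (p0 n0 d0 : nat).
Hypothesis gP : forall p n d,
  nratio R p n d < a <-> forall x, exists y, g x y p n d.

Lemma belowE k i p n d : below p0 n0 d0 k i p n d =
  (nratio R p n d <= i%:R / k.*2.+1%:R + nratio R p0 n0 d0).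
Proof.
have L0 : 0 < k.*2.+1%:R :> R by rewrite ltr0n.
have D0 : 0 < d.+1%:R :> R by rewrite ltr0n.
have D0' : 0 < d0.+1%:R :> R by rewrite ltr0n.
rewrite /below addnn /nratio -[RHS](ler_pM2r (mulr_gt0 (mulr_gt0 L0 D0) D0')).
rewrite -(ler_nat R) !natrD !natrM -[LHS]subr_ge0 -[RHS]subr_ge0.
by congr (_ <= _); field; rewrite !gt_eqF.
Qed.

(** Every rational tested is at most the point, hence below [a], so all its searches succeed.
    Persistence gives the finitely many searches a common stage. *)
Lemma passes_low k i : i%:R / k.*2.+1%:R + nratio R p0 n0 d0 < a ->
  exists s, passes g p0 n0 d0 k i s.
Proof.
move=> ia; apply: eventually_all => [p|p _].
  do 2 (apply: persistent_all => ?); apply: persistent_or.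
  by apply: persistent_all => ?; exact: persistent_has.
apply: eventually_all => [n|n _].
  apply: persistent_all => ?; apply: persistent_or.
  by apply: persistent_all => ?; exact: persistent_has.
apply: eventually_all => [d|d _].
  by apply: persistent_or; apply: persistent_all => ?; exact: persistent_has.
rewrite belowE; have [le_q|_] /= := boolP (_ <= _); last by exists 0%N.
apply: eventually_all => [x|x _]; first exact: persistent_has.
have [y gy] := (gP p n d).1 (le_lt_trans le_q ia) x.
by exists y.+1; apply/hasP; exists y => //; rewrite mem_iota /=.
Qed.

(** Fix a rational [q] strictly between [a] and [a + e], and an [x] at which its Pi_2 condition
    fails. Once [k] exceeds [x] and the name of [q], this failure stops every point at or above [q],
    whatever [i] and [s] are. *)
Lemma passes_high e : 0 < e -> exists K, forall k i s, (K <= k)%N ->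
  passes g p0 n0 d0 k i s -> i%:R / k.*2.+1%:R + nratio R p0 n0 d0 < a + e.
Proof.
move=> e0; have aae : a < a + e by rewrite ltrDl.
have [p [n [d /andP[aq qe]]]] := nratio_between aae.
have : ~ forall x, exists y, g x y p n d.
  by move=> /gP; rewrite ltNge ltW.
move=> /existsNP[x Hx].
exists (p + n + d + x).+1%N => k i s Kk ps.
rewrite ltNge; apply/negP => le_i; apply: Hx.
move: ps => /all_iotaP/(_ p ltac:(lia))/all_iotaP/(_ n ltac:(lia)).
move=> /all_iotaP/(_ d ltac:(lia)); rewrite belowE.
rewrite (le_trans (ltW qe) le_i) /= => /all_iotaP/(_ x ltac:(lia)).
by move=> /hasP[y _ gy]; exists y.
Qed.

End Cut.

End Construction.

(** * Differences of persistent events are 2-c.e *)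

Section Difference.
Local Open Scope nat_scope.
Local Open Scope card_scope.

Lemma persistent_stable b : persistent b ->
  exists s0, forall s, s0 <= s -> b s = `[< exists t, b t >].
Proof.
move=> mb; have [[s0 bs0]|nb] := pselect (exists t, b t).
  by exists s0 => s s0s; rewrite asboolT; [exact: mb bs0 | exists s0].
exists 0 => s _; rewrite asboolF//; apply/negP => bs.
by apply: nb; exists s.
Qed.

Lemma persistent_jump b : persistent b ->
  exists s0, forall s, b s != b s.+1 -> s = s0.
Proof.
move=> mb; have [[s0 bs0]|nb] := pselect (exists s, b s != b s.+1).
  exists s0 => s bs; apply/eqP.
  have jump t : b t != b t.+1 -> ~~ b t /\ b t.+1.
    by have := mb t t.+1 (leqnSn t); case: (b t) (b t.+1) => -[]//= /(_ isT).
  have [/negP n0 y0] := jump _ bs0; have [/negP n1 y1] := jump _ bs.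
  rewrite eqn_leq; apply/andP; split; rewrite leqNgt; apply/negP => lt.
  - by apply: n1; exact: mb y0.
  - by apply: n0; exact: mb y1.
by exists 0 => s bs; case: nb; exists s.
Qed.

(** The approximation [al && ~~ be] can change only where [al] or [be] jumps, and a persistent
    predicate jumps at most once. *)
Lemma n_ce_difference n (al be : nat -> nat -> bool) : 2 <= n ->
  computes 2 (fun s => al (nth 0 s 0) (nth 0 s 1)) ->
  computes 2 (fun s => be (nth 0 s 0) (nth 0 s 1)) ->
  (forall x, persistent (al x)) -> (forall x, persistent (be x)) ->
  (forall x, al x 0 = false) ->
  n_ce n [set x | (exists s, al x s) /\ ~ exists s, be x s].
Proof.
move=> n2 ca cb ma mb a0; exists (fun x s => al x s && ~~ be x s); split.
- have [c Hc] := computes_andb ca (computes_negb cb).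
  by exists c => v; have := Hc v; rewrite !(tnth_nth 0).
- by move=> x; rewrite a0.
- move=> x; have [s1 H1] := persistent_stable (ma x).
  have [s2 H2] := persistent_stable (mb x).
  exists (maxn s1 s2) => // s /=; rewrite geq_max => /andP[l1 l2].
  by rewrite H1// H2// -asbool_neg -asbool_and.
- move=> x; have [s1 H1] := persistent_jump (ma x).
  have [s2 H2] := persistent_jump (mb x).
  apply: (@card_le_trans _ _ _ ((fun i => if i == 0 then s1 else s2) @` `I_2)).
    apply: subset_card_le => s /= ds.
    have [aE|aN] := eqVneq (al x s) (al x s.+1); last first.
      by exists 0 => //=; exact/esym/H1.
    exists 1 => //=; apply/esym/H2; apply: contra ds => /eqP ->.
    by rewrite aE.
  apply: card_le_trans (card_image_le _ _) _.
  by rewrite card_le_II.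
Qed.

End Difference.

(** * The set with density [a - b] *)

Section Density.
Variable R : realType.

Lemma computes_passes (g : nat -> nat -> nat -> nat -> nat -> bool) p0 n0 d0 :
  computes 5 (fun s =>
    g (nth 0 s 0) (nth 0 s 1) (nth 0 s 2) (nth 0 s 3) (nth 0 s 4))%N ->
  computes 2 (fun s => passes g p0 n0 d0 (isqrt (nth 0 s 0))
    (nth 0 s 0 - isqrt (nth 0 s 0) * isqrt (nth 0 s 0)) (nth 0 s 1))%N.
Proof.
move=> cg; rewrite /passes /below.
repeat first [computes_step | apply: computes_isqrt
             | apply: (@computes_apply5 _ g)].
Qed.

Lemma density_setT : has_density [set: nat] (1 : R).
Proof.
apply: cvg_near_cst; exists 1%N => // m /= m0; rewrite rhoE.
rewrite (eq_bigr (fun=> 1%N)) => [|j _]; last by rewrite in_setT.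
by rewrite sum_nat_const_nat subn0 muln1 divff// pnatr_eq0; lia.
Qed.

Lemma density_of_D2 n (r : R) : (2 <= n)%N -> 0 <= r <= 1 -> D2 R r ->
  n_ce_densities R n r.
Proof.
move=> n2 /andP[r0 r1] [a [b [+ + rE]]].
move=> /left_Pi02P[ga ca gaP] /left_Pi02P[gb cb gbP].
(* The case [r = 1] is separate because the interval from [b - (1 - r)] to [b] in which [c] is
   chosen would be empty. *)
have [r1'|r1'] := leP 1 r.
  have -> : r = 1 by lra.
  exists [set: nat]; last exact: density_setT.
  have -> : [set: nat] =
      [set x | (exists s, (0 < s)%N) /\ ~ exists s : nat, false].
    by apply/seteqP; split=> // x _; split; [exists 1%N | case].
  apply: (@n_ce_difference n (fun _ s => 0 < s)%N (fun _ _ => false)) => //.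
  - by computes_tac.
  - exact: computes_cst.
  - by move=> _ s t st s0; exact: leq_trans st.
have [p0 [n0 [d0]]] : exists p n d, b - (1 - r) < nratio R p n d < b.
  by apply: nratio_between; lra.
set c := nratio R p0 n0 d0 => /andP[c1 c2].
pose blk g x s := passes g p0 n0 d0 (isqrt x) (x - isqrt x * isqrt x)%N s.
(* The guard makes stage 0 false; in block [k = 0] the test [passes] holds vacuously even there. *)
pose al x s := (0 < s)%N && blk ga x s.
pose A := [set x | (exists s, al x s) /\ ~ exists s, blk gb x s].
exists A.
  apply: n_ce_difference => //.
  - rewrite /al /blk; apply: computes_andb; last exact: computes_passes.
    by computes_tac.
  - exact: computes_passes.
  - move=> x s t st /andP[s0 ps]; rewrite /al (leq_trans s0 st)/=.
    exact: persistent_passes ps.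
  - by move=> x; exact: persistent_passes.
rewrite /has_density.
have -> : rho R A = fun m => (\sum_(0 <= j < m) (j \in A))%:R / m%:R.
  by apply/funext => m; exact: rhoE.
apply: square_blocks_density; first by rewrite r0 r1.
move=> e e0.
have [K HK] := passes_high p0 n0 d0 gaP e0.
have [K' HK'] := passes_high p0 n0 d0 gbP e0.
exists (maxn K K') => k Kk.
set L := k.*2.+1; have L0 : 0 < L%:R :> R by rewrite ltr0n.
have blkE g i s : (i < L)%N -> blk g (k * k + i)%N s = passes g p0 n0 d0 k i s.
  by move=> iL; rewrite /blk isqrtE// addKn.
(* Points with [b + e <= c + i/L < a] are certainly in [A]; conversely, by [Ahigh], points of [A]
   satisfy [b <= c + i/L < a + e]. Only points within [e] above a cut remain undecided. *)
have Alow i : (i < L)%N ->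
    (b - c + e) * L%:R <= i%:R -> i%:R < (a - c) * L%:R ->
    (k * k + i)%N \in A.
  rewrite -ler_pdivlMr// -ltr_pdivrMr// => iL lo hi.
  rewrite inE; split.
    have [s ps] : exists s, passes ga p0 n0 d0 k i s.
      by apply: (passes_low gaP); rewrite -/c -/L; lra.
    exists s.+1; rewrite /al blkE//=; exact: persistent_passes ps.
  have K'k : (K' <= k)%N by exact: leq_trans (leq_maxr _ _) Kk.
  move=> [s]; rewrite (blkE _ _ _ iL) => /(HK' k i s K'k).
  by apply/negP; rewrite -/c -/L -leNgt; lra.
have Ahigh i : (i < L)%N -> (k * k + i)%N \in A ->
    (b - c) * L%:R <= i%:R /\ i%:R < (a - c + e) * L%:R.
  rewrite -ler_pdivlMr// -ltr_pdivrMr// => iL; rewrite inE => -[[s]] .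
  have kK : (K <= k)%N by exact: leq_trans (leq_maxl _ _) Kk.
  rewrite /al (blkE _ _ _ iL) => /andP[_ /(HK k i s kK)].
  rewrite -/c -/L => hi nb.
  split; last lra.
  rewrite leNgt; apply/negP => lo; apply: nb.
  have [t pt] : exists s, passes gb p0 n0 d0 k i s.
    by apply: (passes_low gbP); rewrite -/c -/L; lra.
  by exists t; rewrite (blkE _ _ _ iL).
pose cnt y := (\sum_(0 <= i < L) (i%:R < y :> R)%R)%N.
set N := (\sum_(0 <= i < L) _)%N.
(* Both bounds on [N] are proved pointwise, in additive form to avoid truncated subtraction. For
   points outside [A] this one uses [b <= a], that is [r >= 0]. *)
have up : (N + cnt ((b - c) * L%:R)%R <= cnt ((a - c + e) * L%:R)%R)%N.
  rewrite /N /cnt -big_split/= big_nat [leqRHS]big_nat leq_sum// => i /= iL.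
  have mono : i%:R < (b - c) * L%:R -> i%:R < (a - c + e) * L%:R.
    by move=> /lt_le_trans; apply; rewrite ler_pM2r//; lra.
  case: (boolP (_ \in A)) => [/(Ahigh i iL)[lo ->]|_].
    by rewrite ltNge lo.
  by case: ltP => // /mono ->.
have lo : (cnt ((a - c) * L%:R)%R <= N + cnt ((b - c + e) * L%:R)%R)%N.
  rewrite /N /cnt -big_split/= big_nat [leqRHS]big_nat leq_sum// => i /= iL.
  case: (ltP i%:R ((a - c) * _)) => // hi.
  case: (ltP i%:R ((b - c + e) * _)) => [_|lo].
    by rewrite addn1.
  by rewrite Alow.
(* The choice of [c] puts [b - c] and [a - c] in [[0, 1]], as the counting lemmas require. With [up]
   and [lo], the four estimates place [N] within [e L + 1] of [r L]. *)
have c1' : (cnt ((b - c) * L%:R))%:R >= (b - c) * L%:R.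
  by apply: count_below_ge; rewrite ler_piMl//; lra.
have c2' : (cnt ((a - c + e) * L%:R))%:R <= (a - c + e) * L%:R + 1.
  by apply: count_below_le; rewrite mulr_ge0//; lra.
have c3' : (cnt ((a - c) * L%:R))%:R >= (a - c) * L%:R.
  by apply: count_below_ge; rewrite ler_piMl//; lra.
have c4' : (cnt ((b - c + e) * L%:R))%:R <= (b - c + e) * L%:R + 1.
  by apply: count_below_le; rewrite mulr_ge0//; lra.
move: up lo; rewrite -!(ler_nat R) !natrD => up lo.
have -> : r = a - b by [].
by rewrite ler_distl; apply/andP; split; nra.
Qed.

End Density.

Theorem corollary4p3 (R : realType) (n : nat) (hn : (2 <= n)%N) :
  (forall r : R, n_ce_densities R n r <-> 0 <= r <= 1 /\ D2 R r) /\
  n_ce_densities R n = n_ce_densities R 2.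
Proof.
have main k : (2 <= k)%N ->
    forall r : R, n_ce_densities R k r <-> 0 <= r <= 1 /\ D2 R r.
  move=> k2 r; split=> [[A Ak rA]|[r01 rD]]; last exact: density_of_D2.
  by split; [exact: density_itv rA | exact: D2_of_density Ak rA].
split; first exact: main.
by apply/seteqP; split=> r /main-/(_ _)/main; apply.
Qed.
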